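(* For $n=2$, the symmetric quantum graph $G^{\mathrm{sym}}$ on $M_2$ is $2$-colourable. For $n\ge3$, the symmetric quantum graph $G^{\mathrm{sym}}$ on $M_n$ is not colourable, i.e. it has no $k$-colouring for any $k\in\mathbb N$.
   Context: $M_n=M_n(\mathbb C)$; ''projector'' means orthogonal projector. The symmetric quantum graph $G^{\mathrm{sym}}$ on $M_n$ has adjacency operator $x\mapsto\tfrac12(\mathrm{Tr}(x)I+x^{T})-\tfrac1n x$; its operator space is $S=\{x\in M_n: x^T=x,\ \mathrm{Tr}(x)=0\}$. A $k$-colouring of a quantum graph with operator space $S$ is a family of non-zero projectors $P_1,\dots,P_k$ on $\mathbb C^n$ with $\sum_sP_s=I$ and $P_sxP_s=0$ for all $x\in S$ and all $s\in\{1,\dots,k\}$. *)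

(* Defs.v *)
From HB Require Import structures.
From mathcomp Require Import all_boot all_order all_algebra.
From mathcomp Require Import reals.
From mathcomp Require Import complex.

Set Implicit Arguments.
Unset Strict Implicit.
Unset Printing Implicit Defensive.

Import Order.TTheory GRing.Theory Num.Theory.

Local Open Scope ring_scope.
Local Open Scope complex_scope.

Section QuantumGraph.
Variables (R : realType) (n : nat).
Local Notation C := R[i].

Definition projector (P : 'M[C]_n) : Prop :=
  P \is hermsymmx /\ P *m P = P.

Definition colouring (S : {pred 'M[C]_n}) (k : nat) (P : 'I_k -> 'M[C]_n) :
    Prop :=
  [/\ forall s, projector (P s) /\ P s != 0,
      \sum_s P s = 1%:M &
      forall x, x \in S -> forall s, P s *m x *m P s = 0].

Definition colourable (S : {pred 'M[C]_n}) (k : nat) : Prop :=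
  exists P : 'I_k -> 'M[C]_n, colouring S P.

Definition sym_adjacency (x : 'M[C]_n) : 'M[C]_n :=
  2%:R^-1 *: ((\tr x)%:M + x^T) - n%:R^-1 *: x.

Definition sym_opspace : {pred 'M[C]_n} :=
  [pred x : 'M[C]_n | (x^T == x) && (\tr x == 0)].

(* If A y = \sum_k e_k *m y *m e_k^* with (e_k) orthonormal for Tr (a^* b), then
   x |-> \sum_(i, j) A E_ij *m x *m E_ji = \sum_k Tr (e_k^* x) e_k is the
   orthogonal projection onto the span of the e_k, the operator space of A. *)
Lemma sym_opspaceP (x : 'M[C]_n) : (0 < n)%N ->
  x \in sym_opspace <->
  \sum_i \sum_j sym_adjacency (delta_mx i j) *m x *m delta_mx j i = x.
Proof.
move=> n_gt0.
have n0 : n%:R != 0 :> C by rewrite pnatr_eq0 -lt0n.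
have deltaE (a b i j : 'I_n) (y : 'M[C]_n) :
    delta_mx a b *m y *m delta_mx i j = y b i *: delta_mx a j.
  rewrite {1}[y]matrix_sum_delta mulmx_sumr mulmx_suml (bigD1 b) //=.
  rewrite [X in _ + X]big1 ?addr0 => [|l lb]; last first.
    rewrite mulmx_sumr mulmx_suml big1 // => m _.
    by rewrite -scalemxAr mul_delta_mx_0 1?eq_sym // scaler0 mul0mx.
  rewrite mulmx_sumr mulmx_suml (bigD1 i) //= big1 ?addr0 => [|m mi].
    by rewrite -scalemxAr -scalemxAl !mul_delta_mx.
  by rewrite -scalemxAr -scalemxAl mul_delta_mx mul_delta_mx_0 // scaler0.
have tr_delta (i j : 'I_n) : \tr (delta_mx i j) = (i == j)%:R :> C.
  rewrite /mxtrace (bigD1 i) //= big1 ?addr0 ?mxE ?eqxx // => l li.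
  by rewrite mxE (negPf li).
have -> : \sum_i \sum_j sym_adjacency (delta_mx i j) *m x *m delta_mx j i =
    2%:R^-1 *: (x + x^T) - n%:R^-1 *: (\tr x)%:M.
  transitivity (\sum_(i < n) \sum_(j < n)
    (2%:R^-1 *: ((i == j)%:R *: (x *m delta_mx j i) + x i j *: delta_mx j i)
     - n%:R^-1 *: (x j j *: delta_mx i i))).
    apply: eq_bigr => i _; apply: eq_bigr => j _.
    rewrite /sym_adjacency tr_delta trmx_delta !mulmxBl -!scalemxAl.
    by rewrite !mulmxDl !deltaE mul_scalar_mx -scalemxAl.
  under eq_bigr => i _ do rewrite sumrB -!scaler_sumr big_split /=.
  rewrite sumrB -!scaler_sumr big_split /=; congr (_ *: (_ + _) - _ *: _).
  - rewrite -[RHS]mulmx1 mx1_sum_delta mulmx_sumr; apply: eq_bigr => i _.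
    rewrite (bigD1 i) //= eqxx scale1r big1 ?addr0 // => j ji.
    by rewrite eq_sym (negPf ji) scale0r.
  - rewrite exchange_big /= [RHS]matrix_sum_delta.
    by apply: eq_bigr => i _; apply: eq_bigr => j _; rewrite mxE.
  - rewrite -[RHS]scalemx1 mx1_sum_delta scaler_sumr.
    by apply: eq_bigr => i _; rewrite -scaler_suml.
have half2 (y : 'M[C]_n) : 2%:R^-1 *: (y + y) = y.
  by rewrite -mulr2n -[y *+ 2]scaler_nat scalerA mulVf ?scale1r // pnatr_eq0.
split=> [/andP[/eqP xT /eqP ->]|xE].
  by rewrite xT half2 raddf0 scaler0 subr0.
have xT : x^T = x.
  have /esym := congr1 trmx xE.
  by rewrite linearB !linearZ /= linearD /= trmxK tr_scalar_mx
    scalerN [x^T + x]addrC xE.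
rewrite inE xT eqxx /=; move: xE; rewrite xT half2 => /eqP.
rewrite -subr_eq0 addrAC subrr add0r oppr_eq0 => /eqP/(congr1 mxtrace)/eqP.
by rewrite mxtrace0 mxtraceZ mxtrace_scalar -[\tr x *+ n]mulr_natl
  mulrA mulVf // mul1r.
Qed.

End QuantumGraph.

(* Main.v *)
(** A diagonal entry [b] of [P x P = 0], for [x] symmetric and traceless, reads
    [\sum_(i, j) v_i^* x_ij v_j = 0], where [v] is the [b]-th column of [P].
    Hence all [|v_i|^2] are equal, to [c] say, and [q_ij = v_i^* v_j] is
    antisymmetric off the diagonal.  With three distinct indices,
    [c q_02 = q_01 q_12 = q_10 q_21 = c q_20 = - c q_02], while
    [c^2 = q_02 q_20 = - q_02^2]; so [c = 0], and any such [P] vanishes when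
    [n >= 3].  For [n = 2] the operator space is spanned by the real Pauli
    matrices, and the spectral projectors of the third one are a colouring. *)
Require Import Defs.
From mathcomp Require Import all_boot all_order all_algebra.
From mathcomp Require Import reals complex.
From mathcomp Require Import ring.

Set Implicit Arguments.
Unset Strict Implicit.
Unset Printing Implicit Defensive.

Import Order.TTheory GRing.Theory Num.Theory.

Local Open Scope ring_scope.

Lemma mul_delta_mx_entry (K : comNzRingType) n (A B : 'M[K]_n) (i j a b : 'I_n) :
  (A *m delta_mx i j *m B) a b = A a i * B j b.
Proof.
(* Factoring the matrix unit through dimension 1 turns the product into column [i] of [A] times row
   [j] of [B]. *)
rewrite -(mul_delta_mx (0 : 'I_1)) mulmxA -mulmxA -colE -rowE.
by rewrite mxE big_ord1 !mxE.
Qed.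

Lemma mxtrace_delta (K : pzSemiRingType) n (i j : 'I_n) :
  \tr (delta_mx i j : 'M[K]_n) = (i == j)%:R.
Proof.
rewrite /mxtrace (bigD1 i) //= big1 ?addr0 ?mxE ?eqxx // => l /negPf li.
by rewrite mxE li.
Qed.

Lemma antisym_rank1_eq0 (K : numFieldType) n (u v : 'I_n -> K) : (3 <= n)%N ->
  (forall i j, i != j -> u i * v j + u j * v i = 0) ->
  (forall i j, u i * v i = u j * v j) ->
  forall i, u i * v i = 0.
Proof.
case: n u v => [|[|[|n]]] // u v _ anti diag i.
pose i0 : 'I_n.+3 := ord0; pose i1 : 'I_n.+3 := inord 1.
pose i2 : 'I_n.+3 := inord 2.
have d01 : i0 != i1 by rewrite -val_eqE /= inordK.
have d12 : i1 != i2 by rewrite -val_eqE /= !inordK.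
have d02 : i0 != i2 by rewrite -val_eqE /= inordK.
rewrite (diag i i0).
have h10 : u i1 * v i0 = - (u i0 * v i1)
  by apply/eqP; rewrite -addr_eq0 addrC anti.
have h21 : u i2 * v i1 = - (u i1 * v i2)
  by apply/eqP; rewrite -addr_eq0 addrC anti.
have h20 : u i2 * v i0 = - (u i0 * v i2)
  by apply/eqP; rewrite -addr_eq0 addrC anti.
(* The matrix [u i * v j] has rank one, so column indices may be exchanged in a product of two
   entries, once the common diagonal value is read at index 1 (or 2 in [e3]). *)
have e1 : (u i0 * v i0) * (u i0 * v i2) = (u i0 * v i1) * (u i1 * v i2).
  by rewrite (diag i0 i1); ring.
have e2 : (u i0 * v i0) * (u i2 * v i0) = (u i1 * v i0) * (u i2 * v i1).
  by rewrite {1}(diag i0 i1); ring.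
have e3 : (u i0 * v i0) ^+ 2 = - (u i0 * v i2) ^+ 2.
  rewrite expr2 [X in _ * X](diag i0 i2) expr2 -mulrN -h20; ring.
(* Characteristic 0 allows division by 2: either the diagonal value is 0, or [u i0 * v i2 = 0] and
   [e3] makes its square 0. *)
have : (u i0 * v i0) * (u i0 * v i2) *+ 2 = 0.
  by apply/eqP; rewrite mulr2n addr_eq0 -mulrN -h20 e2 h10 h21 mulrNN e1.
move/eqP; rewrite mulrn_eq0 /= mulf_eq0 => /orP[/eqP //|/eqP q0].
by move/eqP: e3; rewrite q0 expr0n oppr0 expf_eq0 /= => /eqP.
Qed.

Lemma conj_entry_hermsymmx (K : numClosedFieldType) n (P : 'M[K]_n) i j :
  P \is hermsymmx -> P i j = (P j i)^*%R.
Proof.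
by move=> /is_hermitianmxP hP; rewrite {1}hP expr0 scale1r !mxE.
Qed.

Lemma hermsymmx_compression_eq0 (R : realType) n (P : 'M[R[i]]_n) :
  (3 <= n)%N -> P \is hermsymmx ->
  (forall x, x \in @sym_opspace R n -> P *m x *m P = 0) -> P = 0.
Proof.
move=> n3 hP Px0; apply/matrixP => a b; rewrite [RHS]mxE.
have conjP := conj_entry_hermsymmx _ _ hP.
have entryD (A B : 'M[R[i]]_n) : (A + B) b b = A b b + B b b by rewrite mxE.
have entryN (A : 'M[R[i]]_n) : (- A) b b = - A b b by rewrite mxE.
(* Test matrices: [E_ij + E_ji] here, [E_ii - E_jj] for [diag]. *)
have anti i j : i != j -> P b i * P j b + P b j * P i b = 0.
  move=> ij; have /Px0/matrixP/(_ b b) :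
      delta_mx i j + delta_mx j i \in @sym_opspace R n.
    rewrite inE linearD /= !trmx_delta [X in X == _]addrC eqxx /= linearD /=.
    by rewrite !mxtrace_delta (negPf ij) [j == i]eq_sym (negPf ij) addr0.
  by rewrite mulmxDr mulmxDl entryD !mul_delta_mx_entry mxE.
have diag i j : P b i * P i b = P b j * P j b.
  have /Px0/matrixP/(_ b b) :
      delta_mx i i - delta_mx j j \in @sym_opspace R n.
    rewrite inE linearB /= !trmx_delta eqxx /= linearB /=.
    by rewrite !mxtrace_delta !eqxx subrr.
  rewrite mulmxBr mulmxBl entryD entryN !mul_delta_mx_entry mxE.
  by move/eqP; rewrite subr_eq0 => /eqP.
have /eqP := @antisym_rank1_eq0 _ _ (P b) (P^~ b) n3 anti diag a.
(* Hermitian symmetry turns [P b a * P a b] into the squared modulus of [P a b]. *)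
by rewrite (conjP b a) mulrC mul_conjC_eq0 => /eqP.
Qed.

(** With [Y = [[0, -i], [i, 0]]], this is [(1 + Y)/2] for [b = false] and [(1 - Y)/2] for
    [b = true]. *)
Definition pauli_projector (K : numClosedFieldType) (b : bool) : 'M[K]_2 :=
  \matrix_(i, j) (2%:R^-1 *
    (if i == j then 1 else (-1) ^+ (b (+) (i == 0)) * 'i)).

Lemma pauli_projector_sqr (K : numClosedFieldType) b :
  pauli_projector K b *m pauli_projector K b = pauli_projector K b.
Proof.
have ii : 'i * 'i = -1 :> K by rewrite -expr2 sqrCi.
apply/matrixP => i j; rewrite !mxE !big_ord_recl big_ord0 !mxE.
case: i => [[|[|//]] ?]; case: j => [[|[|//]] ?]; case: b => /=;
  rewrite -?val_eqE /= ?expr0 ?expr1; by field: ii.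
Qed.

Lemma pauli_projector_hermsymmx (K : numClosedFieldType) b :
  pauli_projector K b \is hermsymmx.
Proof.
apply/is_hermitianmxP; rewrite expr0 scale1r.
apply/matrixP => i j; rewrite !mxE rmorphM fmorphV /= conjC_nat eq_sym.
case: i => [[|[|//]] ?]; case: j => [[|[|//]] ?]; case: b;
  rewrite -?val_eqE /= ?expr0 ?expr1 ?rmorph1 // rmorphM /= conjCi;
  by rewrite ?rmorphN rmorph1 mulrN ?mulN1r ?mul1r ?opprK.
Qed.

(** Such an [x] is [[[p, q], [q, -p]]] and anticommutes with [Y]; moving it to the left leaves the
    factor [(1 - Y)(1 + Y) = 1 - Y^2 = 0]. The proof checks this entrywise. *)
Lemma pauli_projector_compression (K : numClosedFieldType) b (x : 'M[K]_2) :
  x^T = x -> \tr x = 0 -> pauli_projector K b *m x *m pauli_projector K b = 0.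
Proof.
set o1 : 'I_2 := lift ord0 ord0.
move=> /matrixP/(_ ord0 o1); rewrite mxE => x10.
rewrite /mxtrace big_ord_recl big_ord1 => /eqP.
rewrite addrC addr_eq0 => /eqP x11.
have ii : 'i * 'i = -1 :> K by rewrite -expr2 sqrCi.
apply/matrixP => i j; rewrite -mulmxA !mxE !big_ord_recl !big_ord0 !mxE.
rewrite !big_ord_recl !big_ord0 !mxE -/o1 x10 x11.
case: i => [[|[|//]] ?]; case: j => [[|[|//]] ?]; case: b => /=;
  rewrite -?val_eqE /= ?expr0 ?expr1; by field: ii.
Qed.

Theorem proposition4p23 (R : realType) :
  colourable (@sym_opspace R 2) 2 /\
  (forall n : nat, (3 <= n)%N ->
     forall k : nat, ~ colourable (@sym_opspace R n) k).
Proof.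
split; last first.
  move=> n n3 k [P [projP sumP PxP]].
  have P0 s : P s = 0.
    have [[hP _] _] := projP s.
    by apply: hermsymmx_compression_eq0 => // x xS; apply: PxP.
  (* The contradiction is [0 = 1] on the diagonal of the sum, which also excludes the empty family
     [k = 0]. *)
  pose i : 'I_n := Ordinal (ltnW (ltnW n3)).
  move: sumP; rewrite big1 // => /matrixP/(_ i i).
  by rewrite !mxE eqxx => /eqP; rewrite eq_sym oner_eq0.
exists (fun s => pauli_projector _ (s == 0)).
split=> [s||x /andP[/eqP xT /eqP x0] s].
- split.
    by split; [exact: pauli_projector_hermsymmx | exact: pauli_projector_sqr].
  apply/eqP => /matrixP/(_ 0 0)/eqP.
  by rewrite !mxE eqxx mulr1 invr_eq0 pnatr_eq0.
- rewrite big_ord_recl big_ord1; apply/matrixP => i j; rewrite !mxE.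
  by case: i => [[|[|//]] ?]; case: j => [[|[|//]] ?];
    rewrite -?val_eqE /= ?expr0 ?expr1; field.
- exact: pauli_projector_compression.
Qed.
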